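(* For all sufficiently large positive integers $n$, the size-Ramsey number of the path $P_n$ satisfies $\hat{r}(P_n) < 137n$.
   Context: $P_n$ denotes the path on $n$ vertices. For graphs $F$ and $G$, write $G \to F$ if every colouring of the edges of $G$ with two colours yields a monochromatic copy of $F$. The size-Ramsey number of $F$ is $\hat{r}(F) = \min\{|E(G)| : G \to F\}$. *)

(* Defs.v *)
From mathcomp Require Import all_boot.
Set Implicit Arguments. Unset Strict Implicit. Unset Printing Implicit Defensive.

Record graph := Graph {
  gorder : nat;
  adj : rel 'I_gorder;
  adj_sym : symmetric adj;
  adj_irr : irreflexive adj
}.
Arguments adj : clear implicits.

Definition num_edges (G : graph) : nat :=
  #|[set p : 'I_(gorder G) * 'I_(gorder G) | (p.1 < p.2) && adj G p.1 p.2]|.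

(* A 2-edge-colouring of G: a colour (bool) for each unordered pair of
   vertices (only the values on edges matter). *)
Definition edge_colouring (G : graph) := 
  { c : 'I_(gorder G) -> 'I_(gorder G) -> bool | forall x y, c x y = c y x }.

Definition arrows (G F : graph) : Prop :=
  forall c : edge_colouring G, exists (b : bool) (f : 'I_(gorder F) -> 'I_(gorder G)),
    injective f /\
    forall i j, adj F i j -> adj G (f i) (f j) /\ sval c (f i) (f j) = b.

Definition path_adj (n : nat) : rel 'I_n :=
  fun i j => (i.+1 == j :> nat) || (j.+1 == i :> nat).

Arguments path_adj : clear implicits.
Lemma path_adj_sym n : symmetric (path_adj n).
Proof. by move=> i j; rewrite /path_adj orbC. Qed.

Lemma path_adj_irr n : irreflexive (path_adj n).
Proof. by move=> i; rewrite /path_adj (gtn_eqF (ltnSn i)). Qed.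

Definition path_graph (n : nat) : graph :=
  @Graph n (path_adj n) (@path_adj_sym n) (@path_adj_irr n).

Definition is_size_ramsey (F : graph) (r : nat) : Prop :=
  (exists G : graph, arrows G F /\ num_edges G = r) /\
  (forall G : graph, arrows G F -> r <= num_edges G).

(* Main.v *)
(** Let G have 7n vertices and suppose that any two disjoint n-sets of vertices
    are joined by an edge.  Colour the edges and suppose that there is no
    monochromatic P_n.  Depth-first search in the first colour, whose stack
    always has fewer than n vertices, yields disjoint 3n-sets A and B with no
    edge of that colour between them; depth-first search in the second colour
    between A and B yields n-sets, one in A and one in B, with no edge at all
    between them, a contradiction.

    Such a G with at most 136n edges exists by a union bound over 136n ordered
    pairs of vertices chosen independently and uniformly: they miss two given
    disjoint n-sets with probability (47/49)^(136n), there are at most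
    (7^7/5^5)^n pairs of disjoint n-sets, and 7^7/5^5 * (47/49)^136 < 1. *)

Require Import Defs.
From mathcomp Require Import all_boot.
From mathcomp Require Import zify.
From Stdlib Require Import Classical.

Set Implicit Arguments.
Unset Strict Implicit.
Unset Printing Implicit Defensive.

(** * Depth-first search stopped at a prescribed weight *)

Section DepthFirstSearch.
(** The weight [w] decides when the search stops. It grows by at most one per exhausted vertex, so
    it cannot jump over [m]. *)
Variables (V : finType) (e : rel V) (w : {set V} -> nat) (l m : nat).
Hypothesis e_sym : symmetric e.
Hypothesis path_short : forall p, uniq p -> sorted e p -> size p < l.
Hypothesis w_add1 : forall x S, w (x |: S) <= (w S).+1.
Hypothesis w_full : m <= w [set: V].

(* S is the set of exhausted vertices and p the stack of the search. *)
Let state (S : {set V}) (p : seq V) :=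
  [/\ uniq p, sorted e p, [disjoint S & p] &
      forall x y, x \in S -> y \notin S -> y \notin p -> ~~ e x y].

(** Each move raises [2 * #|S| + size p] by one: a push lengthens the stack, a pop transfers its top
    to [S]. Only pops change [w S]. *)
Lemma dfs_continue S p : state S p -> w S <= m ->
  exists S' p', state S' p' /\ w S' = m.
Proof.
have [k] := ubnP (2 * #|V| - (2 * #|S| + size p)).
elim: k S p => // k IH S p; rewrite ltnS => le_k st wS.
have [wm|ltw] : w S = m \/ w S < m by lia.
  by exists S, p.
have [up sp dSp noe] := st.
have cardSp (q : seq V) : uniq q -> [disjoint S & q] -> #|S| + size q <= #|V|.
  move=> uq /pred0P d; rewrite -(card_uniqP uq) -cardUI (eq_card0 d) addn0.
  exact: max_card.
have push y : y \notin S -> y \notin p -> sorted e (y :: p) ->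
    exists S' p', state S' p' /\ w S' = m.
  move=> yS yp syp.
  have uyp : uniq (y :: p) by rewrite /= yp.
  have dyp : [disjoint S & y :: p].
    by rewrite disjoint_sym disjoint_cons yS disjoint_sym.
  have := cardSp _ uyp dyp => /= c; apply: (IH S (y :: p)) => //=.
    by move: c le_k => /=; lia.
  split=> // x z xS zS; rewrite inE negb_or => /andP[_ zp]; exact: noe.
case: p => [|x p] in le_k st up sp dSp noe push *.
  (* With an empty stack, any vertex outside [S] starts a new path; if there is none, [w_full]
     contradicts [w S < m]. *)
  have [T0|[y]] := set_0Vmem (~: S); last by rewrite inE => yS; apply: (push y).
  by move: w_full; rewrite -(setCK S) T0 setC0 in ltw * => ?; lia.
have [y /and3P[yS yp exy]|none] :=
    pickP [pred y | [&& y \notin S, y \notin x :: p & e x y]].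
  by apply: (push y) => //=; rewrite e_sym exy.
(* The top [x] has no undiscovered neighbour, so it may be popped into [S]. *)
move: dSp; rewrite disjoint_sym disjoint_cons => /andP[xS dp].
move: up => /= /andP[xp up].
apply: (IH (x |: S) p); last by apply: leq_trans (w_add1 _ _) _.
  have := cardSp (x :: p); rewrite /= xp up disjoint_sym disjoint_cons xS dp.
  by rewrite cardsU1 xS /= in le_k * => /(_ isT isT); lia.
split=> //; first exact: path_sorted sp.
  rewrite disjoint_subset; apply/subsetP => z.
  rewrite !inE => /orP[/eqP->//|zS]; by rewrite (disjointFl dp).
move=> u z; rewrite !inE negb_or => /orP[/eqP->|uS] /andP[zx zS] zp.
  by have := none z; rewrite /= inE negb_or zS zp zx /= => /negbT.
by apply: noe; rewrite ?inE ?negb_or ?zx.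
Qed.

Lemma dfs_cut : w set0 <= m ->
  exists (S : {set V}) (T : {set V}), [/\ w S = m, [disjoint S & T],
    forall x y, x \in S -> y \in T -> ~~ e x y & #|~: (S :|: T)| < l].
Proof.
move=> w0; have [|S [p [[up sp dSp noe] wS]]] := @dfs_continue set0 [::] _ w0.
  split=> // [|x y]; last by rewrite inE.
  by rewrite disjoint_subset; apply/subsetP => x; rewrite inE.
(* [T] is the set of undiscovered vertices; what [S] and [T] leave out is the stack, a path. *)
exists S, [set y | (y \notin S) && (y \notin p)]; split=> //.
- by rewrite disjoint_subset; apply/subsetP => x xS; rewrite !inE xS.
- by move=> x y xS; rewrite inE => /andP[]; apply: noe.
apply: leq_ltn_trans (path_short up sp); rewrite -(card_uniqP up).
apply/subset_leq_card/subsetP => x; rewrite !inE.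
by case: (x \in S) => //=; rewrite negbK.
Qed.

End DepthFirstSearch.

(** * From joined sets to monochromatic paths *)

Lemma path_of_seq (G : graph) (c : edge_colouring G) b n
    (p : seq 'I_(gorder G)) : 0 < n <= size p -> uniq p ->
    sorted (fun x y => adj G x y && (sval c x y == b)) p ->
  exists f : 'I_n -> 'I_(gorder G), injective f /\
    forall i j, path_adj n i j ->
      adj G (f i) (f j) /\ sval c (f i) (f j) = b.
Proof.
case: p => [|x p] /andP[n0 np] up sp; first by rewrite leqn0 in np; lia.
set e := (fun _ _ => _) in sp.
have e_sym : symmetric e by move=> u v; rewrite /e adj_sym (svalP c).
have ltp (i : 'I_n) : i < size (x :: p) by exact: leq_trans (ltn_ord i) np.
have ok (i j : 'I_n) : i.+1 = j -> e (nth x (x :: p) i) (nth x (x :: p) j).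
  move=> ij; rewrite -ij; move/(pathP x): sp; apply.
  by have := ltp j; rewrite -ij.
exists (fun i => nth x (x :: p) i); split.
  by move=> i j /eqP; rewrite nth_uniq // => /eqP /val_inj.
move=> i j /orP[] /eqP /ok; last rewrite e_sym; by case/andP=> ? /eqP.
Qed.

Lemma subset_card (V : finType) (A : {set V}) k : k <= #|A| ->
  exists B : {set V}, B \subset A /\ #|B| = k.
Proof.
move=> kA; exists [set x in take k (enum A)]; split.
  by apply/subsetP => x; rewrite inE => /mem_take; rewrite mem_enum.
rewrite cardsE (card_uniqP _) ?take_uniq ?enum_uniq //.
by rewrite size_takel // -cardE.
Qed.

Definition joined (V : finType) (e : rel V) (k : nat) :=
  forall S T : {set V}, [disjoint S & T] -> #|S| = k -> #|T| = k ->
    exists x y, [/\ x \in S, y \in T & e x y].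

Lemma joined_arrows (G : graph) n : 0 < n -> gorder G = 7 * n ->
  joined (adj G) n -> arrows G (path_graph n).
Proof.
move=> n0 oG jG c; apply: NNPP => noP.
pose e b x y := adj G x y && (sval c x y == b).
have e_sym b : symmetric (e b) by move=> x y; rewrite /e adj_sym (svalP c).
have short b p : uniq p -> sorted (e b) p -> size p < n.
  move=> up sp; rewrite ltnNge; apply/negP => np; apply: noP; exists b.
  by apply: path_of_seq sp; rewrite ?n0.
have cardV : #|[set: 'I_(gorder G)]| = 7 * n by rewrite cardsT card_ord.
have [| | |A [B0 [cA dAB0 noAB0 cR]]] :=
    @dfs_cut _ (e true) (fun S => #|S|) n (3 * n) (e_sym _) (short _).
- by move=> x S; rewrite cardsU1; case: (_ \notin _) => /=; lia.
- by rewrite cardV; lia.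
- by rewrite cards0.
(* Of the [7 * n] vertices, [A] takes [3 * n] and the stack fewer than [n]. *)
have cB0 : 3 * n <= #|B0|.
  have := cardsC (A :|: B0); rewrite cardsU.
  rewrite (_ : A :&: B0 = set0) ?cards0; last first.
    by apply/eqP; rewrite setI_eq0.
  by rewrite -cardsT cardV; lia.
have [B [sB cB]] := subset_card cB0.
have dAB : [disjoint A & B].
  by rewrite disjoint_sym (disjointWl sB) // disjoint_sym.
pose e' x y := e false x y &&
  ((x \in A) && (y \in B) || (x \in B) && (y \in A)).
have e'_sym : symmetric e'.
  move=> x y; rewrite /e' e_sym; congr (_ && _).
  by rewrite orbC ![(y \in _) && _]andbC.
have short' p : uniq p -> sorted e' p -> size p < n.
  move=> up sp; apply: (short false p up); apply: sub_sorted sp.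
  by move=> x y /andP[].
have cardI1 x (S C : {set 'I_(gorder G)}) : #|(x |: S) :&: C| <= #|S :&: C|.+1.
  rewrite setIUl -[_.+1]add1n; apply: leq_trans (leq_card_setU _ _) _.
  by rewrite leq_add2r -(cards1 x) subset_leq_card // subsetIl.
(* Stopping when the larger of the two traces reaches [n] gives one trace of size exactly [n] and
   the other of size at most [n]. *)
have [| | |S [T [wS dST noST cR']]] :=
    @dfs_cut _ e' (fun S => maxn #|S :&: A| #|S :&: B|) n n e'_sym short'.
- by move=> x S; rewrite -maxnSS geq_max !leq_max !cardI1 orbT.
- by rewrite !setTI cA cB maxnn; lia.
- by rewrite !set0I !cards0.
(* [C] is the side whose trace on [S] has size [n]. On the other side [D], at most [n] vertices are
   exhausted and fewer than [n] are on the stack, so at least [n] lie in [T]. *)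
have absurd (C D : {set 'I_(gorder G)}) :
    (forall x y, x \in C -> y \in D -> adj G x y -> e' x y) ->
    [disjoint C & D] -> #|D| = 3 * n -> #|S :&: C| = n -> #|S :&: D| <= n ->
    False.
  move=> noCD dCD cD SC SD.
  have cTD : n <= #|T :&: D|.
    have : #|D| <= #|S :&: D| + (#|T :&: D| + #|~: (S :|: T)|).
      have sD : D \subset (S :&: D) :|: ((T :&: D) :|: ~: (S :|: T)).
        apply/subsetP => x xD; rewrite !inE xD.
        by case: (x \in S) => //=; case: (x \in T).
      apply: leq_trans (subset_leq_card sD) _.
      apply: leq_trans (leq_card_setU _ _) _.
      by rewrite leq_add2l leq_card_setU.
    by rewrite cD; move: SD cR'; lia.
  have [U [sU cU]] := subset_card cTD.
  have [|x [y [xS yU exy]]] := jG (S :&: C) U _ SC cU => //.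
    apply: disjointWr sU _; apply: disjointWl (subsetIl _ _) _.
    by apply: disjointWr (subsetIl _ _) _.
  have [yT yD] : y \in T /\ y \in D.
    by move: (subsetP sU _ yU); rewrite inE => /andP[].
  move: xS; rewrite inE => /andP[xS xC].
  by have := noST _ _ xS yT; rewrite noCD.
have AB x y : x \in A -> y \in B -> adj G x y -> sval c x y = false.
  move=> xA yB exy; have := noAB0 _ _ xA (subsetP sB _ yB).
  by rewrite /e exy; case: (sval c x y).
have [SA|SB] : #|S :&: A| = n \/ #|S :&: B| = n by lia.
  apply: (absurd A B) => //; last by lia.
  by move=> x y xA yB exy; rewrite /e' /e exy (AB x y) ?xA ?yB.
apply: (absurd B A) => //; [|by rewrite disjoint_sym|by lia].
move=> x y xB yA exy; rewrite /e' /e exy (svalP c) (AB y x) ?xB ?yA ?orbT //.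
by rewrite adj_sym.
Qed.

(** * Counting pairs of disjoint sets *)

Lemma card_bigcup_leq (I T : finType) (P : pred I) (F : I -> {set T}) :
  #|\bigcup_(i | P i) F i| <= \sum_(i | P i) #|F i|.
Proof.
apply: (big_ind2 (fun (A : {set T}) k => #|A| <= k)) => [|A k B l Ak Bl|//].
  by rewrite cards0.
by apply: leq_trans (leq_card_setU _ _) _; apply: leq_add.
Qed.

Definition disjoint_pairs (V : finType) (k : nat) :=
  [set D : {set V} * {set V} |
    [&& [disjoint D.1 & D.2], #|D.1| == k & #|D.2| == k]].

(* A pair (S, T) extends in 5^(5n) ways to a map V -> 'I_7 with fibres S and T
   over 0 and 1, and is determined by any of them. *)
Lemma card_disjoint_pairs (V : finType) n : #|V| = 7 * n ->
  #|disjoint_pairs V n| * 5 ^ (5 * n) <= 7 ^ (7 * n).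
Proof.
move=> cV.
pose o0 : 'I_7 := inord 0; pose o1 : 'I_7 := inord 1.
have o01 : o0 != o1 by rewrite -val_eqE /= !inordK.
pose fibre (D : {set V} * {set V}) (x : V) : {set 'I_7} :=
  if x \in D.1 then [set o0] else
  if x \in D.2 then [set o1] else ~: [set o0; o1].
pose X (D : {set V} * {set V}) :=
  [set f : {ffun V -> 'I_7} | f \in family (fibre D)].
pose r (f : {ffun V -> 'I_7}) := ([set x | f x == o0], [set x | f x == o1]).
have rX D f : D \in disjoint_pairs V n -> f \in X D -> r f = D.
  case: D => S T; rewrite !inE => /andP[/= dST _] /familyP fX.
  congr (_, _); apply/setP => x; have := fX x; rewrite /fibre inE /=.
    case: ifP => xS; first by rewrite inE.
    case: ifP => xT; first by rewrite inE => /eqP->; rewrite eq_sym (negPf o01).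
    by rewrite !inE negb_or => /andP[/negPf].
  case: ifP => xS.
    rewrite inE => /eqP->; rewrite (negPf o01).
    by rewrite (disjointFr dST xS).
  case: ifP => xT; first by rewrite inE.
  by rewrite !inE negb_or => /andP[_ /negPf].
have cX D : D \in disjoint_pairs V n -> #|X D| = 5 ^ (5 * n).
  case: D => S T; rewrite !inE => /and3P[/= dST /eqP cS /eqP cT].
  rewrite cardsE card_family foldrE big_map big_enum /=.
  rewrite (bigID [in S]) /= big1 ?mul1n; last first.
    by move=> x xS; rewrite /fibre /= xS cards1.
  rewrite (bigID [in T]) /= big1 ?mul1n; last first.
    by move=> x /andP[/negPf xS xT]; rewrite /fibre /= xS xT cards1.
  rewrite (eq_bigr (fun=> 5)); last first.
    move=> x /andP[/negPf xS /negPf xT]; rewrite /fibre /= xS xT.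
    by rewrite cardsCs setCK cards2 o01 card_ord.
  rewrite prod_nat_const; congr (_ ^ _).
  have -> : #|[pred x | (x \notin S) && (x \notin T)]| = #|~: (S :|: T)|.
    by apply: eq_card => x; rewrite !inE negb_or.
  have := cardsC (S :|: T); rewrite cardsU.
  rewrite (_ : S :&: T = set0) ?cards0; last by apply/eqP; rewrite setI_eq0.
  by rewrite cV; lia.
rewrite -sum_nat_const -(eq_bigr _ cX).
have -> : 7 ^ (7 * n) = \sum_(f : {ffun V -> 'I_7}) 1.
  by rewrite sum1_card card_ffun card_ord cV.
under eq_bigr => D _ do rewrite -sum1_card big_mkcond /=.
(* Double counting: each [f] lies in [X D] for at most one [D], namely [r f]. *)
rewrite exchange_big /=; apply: leq_sum => f _.
rewrite -big_mkcondr sum1_card.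
have [D0|noD] := pickP [pred D | (D \in disjoint_pairs V n) && (f \in X D)].
  move=> /andP[D1 D2]; apply: (@leq_trans #|pred1 D0|); last by rewrite card1.
  apply/subset_leq_card/subsetP => D.
  by case/andP=> D3 D4; rewrite inE -(rX _ _ D1 D2) -(rX _ _ D3 D4).
by rewrite eq_card0.
Qed.

(** * Existence of a sparse joined graph by the union bound *)

Lemma ltn_prod_expn a b c d p q r n : 0 < n ->
  a ^ p * b ^ q < c ^ r * d ^ q ->
  a ^ (p * n) * b ^ (q * n) < d ^ (q * n) * c ^ (r * n).
Proof.
by move=> n0 h; rewrite !expnM -!expnMn ltn_exp2r // [d ^ q * _]mulnC.
Qed.

(** In logarithms, [7 ^ 7 / 5 ^ 5] gives about 5.574 and [(49 / 47) ^ 136] about 5.667. *)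
Lemma numeric_bound : 7 ^ 7 * 47 ^ 136 < 5 ^ 5 * 49 ^ 136.
Proof. lia. Qed.

(** Loops are dropped, orientations forgotten and repetitions merged, so there are at most [#|I|]
    edges. *)
Definition pair_adj (V : finType) (I : finType) (F : I -> V * V) : rel V :=
  fun x y => (x != y) && [exists i, (F i == (x, y)) || (F i == (y, x))].

Lemma pair_adj_sym V I F : symmetric (@pair_adj V I F).
Proof.
move=> x y; rewrite /pair_adj eq_sym; congr (_ && _).
by apply: eq_existsb => i; rewrite orbC.
Qed.

Lemma pair_adj_irr V I F : irreflexive (@pair_adj V I F).
Proof. by move=> x; rewrite /pair_adj eqxx. Qed.

Lemma exists_joined n : 0 < n ->
  exists F : 'I_(136 * n) -> 'I_(7 * n) * 'I_(7 * n), joined (pair_adj F) n.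
Proof.
move=> n0; set M := 136 * n; set V := 'I_(7 * n).
have cV : #|V| = 7 * n by rewrite card_ord.
(* [E D] holds the [2 * n ^ 2] ordered pairs, out of [49 * n ^ 2], that join the two sets; [bad D]
   holds the choices that miss all of them. *)
pose E (D : {set V} * {set V}) := setX D.1 D.2 :|: setX D.2 D.1.
pose bad D := [set F : {ffun 'I_M -> V * V} | F \in ffun_on (~: E D)].
have cbad D : D \in disjoint_pairs V n -> #|bad D| = (47 * n ^ 2) ^ M.
  case: D => S T; rewrite !inE => /and3P[/= dST /eqP cS /eqP cT].
  rewrite cardsE card_ffun_on card_ord; congr (_ ^ _).
  rewrite cardsCs setCK card_prod cV /E /= cardsU !cardsX cS cT.
  rewrite (_ : _ :&: _ = set0) ?cards0; last first.
    apply/setP => -[x y]; rewrite !inE /=; apply/negP.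
    case/andP=> /andP[xS _] /andP[xT _].
    by rewrite (disjointFr dST xS) in xT.
  by rewrite -mulnn; nia.
suff [F noF] : exists F, F \notin \bigcup_(D in disjoint_pairs V n) bad D.
  exists F => S T dST cS cT; apply: NNPP => noe; case/negP: noF.
  apply/bigcupP; exists (S, T); first by rewrite !inE dST cS cT !eqxx.
  rewrite inE; apply/ffun_onP => i; rewrite !inE; apply/negP => /= h.
  apply: noe; case Fi: (F i) h => [x y] /= /orP[]/andP[h1 h2].
    exists x, y; split=> //; apply/andP; split.
      by apply: contraTneq h2 => <-; rewrite (disjointFr dST h1).
    by apply/existsP; exists i; rewrite Fi eqxx.
  exists y, x; split=> //; apply/andP; split.
    by apply: contraTneq h1 => <-; rewrite (disjointFr dST h2).
  by apply/existsP; exists i; rewrite Fi eqxx orbT.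
apply/existsP; rewrite -negb_forall; apply/negP => /forallP all_bad.
have : #|{ffun 'I_M -> V * V}| <= #|disjoint_pairs V n| * (47 * n ^ 2) ^ M.
  rewrite -sum_nat_const -(eq_bigr _ cbad).
  apply: leq_trans (card_bigcup_leq _ _).
  by apply/subset_leq_card/subsetP => F _; apply: all_bad.
apply/negP; rewrite -ltnNge card_ffun card_prod cV card_ord.
rewrite (_ : 7 * n * (7 * n) = 49 * n ^ 2); last by rewrite -mulnn; nia.
rewrite !expnMn mulnA ltn_pmul2r ?muln_gt0 ?expn_gt0 ?n0 //.
(* The factor [5 ^ (5 * n)] makes [card_disjoint_pairs] applicable without division. *)
rewrite -(ltn_pmul2r (_ : 0 < 5 ^ (5 * n))) ?expn_gt0 //.
rewrite mulnAC; apply: (@leq_ltn_trans (7 ^ (7 * n) * 47 ^ M)).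
  by rewrite leq_mul2r card_disjoint_pairs ?orbT.
exact: ltn_prod_expn n0 numeric_bound.
Qed.

(** * The size-Ramsey number and its bound *)

(** Descent on the number of edges: a graph that is not minimal is replaced by a smaller one that
    still arrows [F]. *)
Lemma size_ramsey_exists (F G : graph) : arrows G F ->
  exists r, is_size_ramsey F r /\ r <= num_edges G.
Proof.
have [k] := ubnP (num_edges G); elim: k G => // k IH G; rewrite ltnS => Gk GF.
have [min|] := classic (forall H, arrows H F -> num_edges G <= num_edges H).
  by exists (num_edges G); split=> //; split=> //; exists G.
move/not_all_ex_not => [H nH]; have [HF /negP] := imply_to_and _ _ nH.
rewrite -ltnNge => HG; have [|r [rF rH]] := IH H _ HF; first by lia.
by exists r; split=> //; lia.
Qed.

Theorem theorem1p1 :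
  exists N : nat, forall n : nat, N <= n ->
    exists r : nat, is_size_ramsey (path_graph n) r /\ r < 137 * n.
Proof.
exists 1 => n n0; have [F jF] := exists_joined n0.
pose G := @Graph (7 * n) (pair_adj F)
  (@pair_adj_sym _ _ F) (@pair_adj_irr _ _ F).
have [r [rP rG]] := size_ramsey_exists (@joined_arrows G n n0 erefl jF).
exists r; split=> //; apply: leq_ltn_trans rG _.
suff : num_edges G <= 136 * n by lia.
(* [num_edges] counts increasing pairs; sorting each [F i] with [up] covers them all by an image of
   the [136 * n] indices. *)
pose up (q : 'I_(7 * n) * 'I_(7 * n)) := if q.1 < q.2 then q else (q.2, q.1).
rewrite -[X in _ <= X]card_ord -cardsT.
apply: leq_trans (leq_imset_card (fun i => up (F i)) _).
apply/subset_leq_card/subsetP => -[x y]; rewrite inE /= => /andP[xy].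
case/andP=> _ /existsP[i] /orP[]/eqP Fi; apply/imsetP; exists i => //.
  by rewrite Fi /up /= xy.
by rewrite Fi /up /= ltnNge ltnW.
Qed.
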